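(* Let $F$ be a field, $\Lambda=M_s(F)$, and $A,B,C\in\Lambda$. Then, viewing $G(w)\in\Lambda[[z]]$ as an $s\times s$ matrix with entries in $F[[z]]$, all of its matrix entries are algebraic over $F(z)$.
   Context: A walk of length $l\ge0$ is an $(l+1)$-tuple $\alpha=(\alpha_0,\dots,\alpha_l)$ of integers with each $\alpha_i-\alpha_{i-1}\in\{-1,0,1\}$; it is a walk from $\alpha_0$ to $\alpha_l$. Its weight is $w(\alpha)=1$ if $l=0$, and otherwise $w(\alpha)=U_1U_2\cdots U_l$ where $U_i=A,B,C$ according as $\alpha_i-\alpha_{i-1}=-1,0,1$. A walk is standard if $\alpha_i\ge\alpha_l$ for all $i$. $G(w)=\sum w(\alpha)z^{l(\alpha)}$, the sum over all standard walks from $0$ to $0$. *)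

(* Defs.v *)
From HB Require Import structures.
From mathcomp Require Import all_boot all_order all_algebra.
From mathcomp Require Import boolp classical_sets functions cardinality fsbigop.

Set Implicit Arguments.
Unset Strict Implicit.
Unset Printing Implicit Defensive.

Import Order.TTheory GRing.Theory Num.Theory.
Local Open Scope ring_scope.

(** [fps R] is R[[z]].  It is a wrapper around [nat -> R] because functions
    already carry the pointwise ring structure. *)

Record fps (R : Type) := Fps { fps_coef : nat -> R }.

HB.instance Definition _ (R : Type) := [isNew for @fps_coef R].
HB.instance Definition _ (R : choiceType) := [Choice of fps R by <:].

Lemma fpsP (R : Type) (f g : fps R) : fps_coef f =1 fps_coef g -> f = g.
Proof. by case: f g => f [g] /= fg; congr Fps; apply/funext. Qed.

Section FpsZmod.
Variable R : zmodType.
Implicit Types f g : fps R.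

Definition fps0 : fps R := Fps (fun=> 0).
Definition fps_opp f : fps R := Fps (fun n => - fps_coef f n).
Definition fps_add f g : fps R := Fps (fun n => fps_coef f n + fps_coef g n).

Fact fps_addA : associative fps_add.
Proof. by move=> f g h; apply: fpsP => n /=; rewrite addrA. Qed.
Fact fps_addC : commutative fps_add.
Proof. by move=> f g; apply: fpsP => n /=; rewrite addrC. Qed.
Fact fps_add0 : left_id fps0 fps_add.
Proof. by move=> f; apply: fpsP => n /=; rewrite add0r. Qed.
Fact fps_addN : left_inverse fps0 fps_opp fps_add.
Proof. by move=> f; apply: fpsP => n /=; rewrite addNr. Qed.

HB.instance Definition _ :=
  GRing.isZmodule.Build (fps R) fps_addA fps_addC fps_add0 fps_addN.

Lemma coef_fps0 n : fps_coef (0 : fps R) n = 0. Proof. by []. Qed.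
Lemma coef_fpsD f g n : fps_coef (f + g) n = fps_coef f n + fps_coef g n.
Proof. by []. Qed.
Lemma coef_fpsN f n : fps_coef (- f) n = - fps_coef f n. Proof. by []. Qed.
Lemma coef_fpsB f g n : fps_coef (f - g) n = fps_coef f n - fps_coef g n.
Proof. by []. Qed.

End FpsZmod.

Section FpsPzRing.
Variable R : pzRingType.
Implicit Types f g : fps R.

Definition fps1 : fps R := Fps (fun n => (n == 0)%:R).
Definition fps_mul f g : fps R :=
  Fps (fun n => \sum_(i < n.+1) fps_coef f i * fps_coef g (n - i)).

Lemma fps_mul_rev f g n : fps_coef (fps_mul f g) n =
  \sum_(i < n.+1) fps_coef f (n - i) * fps_coef g i.
Proof.
rewrite /= (reindex_inj rev_ord_inj) /=.
by apply: eq_bigr => i _; rewrite (sub_ordK i).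
Qed.

Fact fps_mulA : associative fps_mul.
Proof.
move=> f g h; apply: fpsP => n; rewrite [RHS]fps_mul_rev.
pose coef3 j i := fps_coef f j * (fps_coef g (n - j - i) * fps_coef h i).
transitivity (\sum_(j < n.+1) \sum_(i < n.+1 | (i <= n - j)%N) coef3 j i).
  apply: eq_bigr => j _; rewrite fps_mul_rev big_distrr /=.
  by rewrite (big_ord_narrow_leq (leq_subr _ _)).
rewrite (exchange_big_dep predT) //=; apply: eq_bigr => i _.
transitivity (\sum_(j < n.+1 | (j <= n - i)%N) coef3 j i).
  apply: eq_bigl => j; rewrite -ltnS -(ltnS j) -!subSn ?leq_ord //.
  by rewrite -subn_gt0 -(subn_gt0 j) -!subnDA addnC.
rewrite (big_ord_narrow_leq (leq_subr _ _)) big_distrl /=.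
by apply: eq_bigr => j _; rewrite /coef3 -!subnDA addnC mulrA.
Qed.

Fact fps_mul1l : left_id fps1 fps_mul.
Proof.
move=> f; apply: fpsP => n /=; rewrite big_ord_recl /= mul1r subn0.
by rewrite big1 ?addr0 // => i _; rewrite mul0r.
Qed.

Fact fps_mul1r : right_id fps1 fps_mul.
Proof.
move=> f; apply: fpsP => n; rewrite fps_mul_rev big_ord_recl /= mulr1 subn0.
by rewrite big1 ?addr0 // => i _; rewrite mulr0.
Qed.

Fact fps_mulDl : left_distributive fps_mul +%R.
Proof.
move=> f g h; apply: fpsP => n /=; rewrite -big_split /=.
by apply: eq_bigr => i _; rewrite mulrDl.
Qed.

Fact fps_mulDr : right_distributive fps_mul +%R.
Proof.
move=> f g h; apply: fpsP => n /=; rewrite -big_split /=.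
by apply: eq_bigr => i _; rewrite mulrDr.
Qed.

HB.instance Definition _ := GRing.Zmodule_isPzRing.Build (fps R)
  fps_mulA fps_mul1l fps_mul1r fps_mulDl fps_mulDr.

Lemma coef_fps1 n : fps_coef (1 : fps R) n = (n == 0)%:R. Proof. by []. Qed.
Lemma coef_fpsM f g n : fps_coef (f * g) n =
  \sum_(i < n.+1) fps_coef f i * fps_coef g (n - i).
Proof. by []. Qed.
Lemma coef_fpsM_rev f g n : fps_coef (f * g) n =
  \sum_(i < n.+1) fps_coef f (n - i) * fps_coef g i.
Proof. exact: fps_mul_rev. Qed.

End FpsPzRing.

Fact fps_oner_neq0 (R : nzRingType) : (1 : fps R) != 0.
Proof.
apply/eqP => /(congr1 (fun f => fps_coef f 0)) /eqP.
by rewrite coef_fps1 coef_fps0 oner_eq0.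
Qed.

HB.instance Definition _ (R : nzRingType) :=
  GRing.PzSemiRing_isNonZero.Build (fps R) (@fps_oner_neq0 R).

Fact fps_mulC (R : comNzRingType) : commutative (@GRing.mul (fps R)).
Proof.
move=> f g; apply: fpsP => n; rewrite coef_fpsM_rev coef_fpsM.
by apply: eq_bigr => i _; rewrite mulrC.
Qed.

HB.instance Definition _ (R : comNzRingType) :=
  GRing.PzRing_hasCommutativeMul.Build (fps R) (@fps_mulC R).

Section FpsUnit.
Variable R : comNzRingType.
Implicit Types f g : fps R.

Definition fps_unit : pred (fps R) := fun f => `[< exists g, g * f = 1 >].
Definition fps_inv f : fps R :=
  if pselect (exists g, g * f = 1) is left ex then xget 0 [set g | g * f = 1]%classic
  else f.

Fact fps_mulVf : {in fps_unit, left_inverse 1 fps_inv *%R}.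
Proof.
move=> f /asboolP ex; rewrite /fps_inv; case: pselect => // -[g gf].
by case: xgetP => [h _ //|/(_ g)].
Qed.
Fact fps_unitPl f g : g * f = 1 -> fps_unit f.
Proof. by move=> gf; apply/asboolP; exists g. Qed.
Fact fps_invr_out : {in [predC fps_unit], fps_inv =1 id}.
Proof. by move=> f /asboolP nex; rewrite /fps_inv; case: pselect. Qed.

HB.instance Definition _ := GRing.ComNzRing_hasMulInverse.Build (fps R)
  fps_mulVf fps_unitPl fps_invr_out.

End FpsUnit.

Section FpsIdomain.
Variable R : idomainType.
Implicit Types f g : fps R.

Lemma fps_neq0P f : f != 0 ->
  exists2 n, fps_coef f n != 0 & forall m, (m < n)%N -> fps_coef f m = 0.
Proof.
move=> f0; have exn : exists n, fps_coef f n != 0.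
  apply: contrapT => nex; case/eqP: f0; apply: fpsP => n.
  by apply/eqP; apply: contrapT => fn; apply: nex; exists n; apply/negP.
case: (ex_minnP exn) => n fn minn; exists n => // m mn; apply/eqP.
by apply: contraTT mn => /minn; rewrite -leqNgt.
Qed.

Fact fps_integral : GRing.integral_domain_axiom (fps R).
Proof.
move=> f g fg0; apply/norP => -[/fps_neq0P[m fm fm0] /fps_neq0P[n gn gn0]].
have /eqP : fps_coef (f * g) (m + n) = 0 by rewrite fg0.
rewrite coef_fpsM (bigD1 (inord m)) //= inordK ?ltnS ?leq_addr // addKn.
rewrite big1 ?addr0 ?mulf_eq0 ?(negPf fm) ?(negPf gn) // => i ineq.
have [im|mi] := ltnP i m; first by rewrite fm0 // mul0r.
have {ineq} : (i : nat) != m.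
  by apply: contraNneq ineq => im; apply/eqP/val_inj; rewrite /= inordK ?im // ltnS leq_addr.
rewrite neq_ltn ltnNge mi /= => mi'.
by rewrite gn0 ?mulr0 // ltn_subLR ?ltn_add2r // -ltnS.
Qed.

HB.instance Definition _ :=
  GRing.ComUnitRing_isIntegral.Build (fps R) fps_integral.

End FpsIdomain.

(** F(z) is [{fraction {poly F}}] and F((z)) is [{fraction fps F}], the fraction
    field of F[[z]]. *)

Definition fps_of_poly (R : nzRingType) (p : {poly R}) : fps R :=
  Fps (fun n => p`_n).

Lemma fps_of_poly_inj (R : nzRingType) : injective (@fps_of_poly R).
Proof. by move=> p q [/(congr1 (@^~ _)) pq]; apply/polyP => n; apply: pq. Qed.

Fact fps_of_poly_is_zmod_morphism (R : nzRingType) :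
  zmod_morphism (@fps_of_poly R).
Proof. by move=> p q; apply: fpsP => n; rewrite coef_fpsB /= coefB. Qed.

Fact fps_of_poly_is_monoid_morphism (R : nzRingType) :
  monoid_morphism (@fps_of_poly R).
Proof.
split=> [|p q]; apply: fpsP => n; first by rewrite coef_fps1 /= coef1.
by rewrite coef_fpsM /= coefM.
Qed.

HB.instance Definition _ (R : nzRingType) := GRing.isZmodMorphism.Build
  {poly R} (fps R) (@fps_of_poly R) (@fps_of_poly_is_zmod_morphism R).
HB.instance Definition _ (R : nzRingType) := GRing.isMonoidMorphism.Build
  {poly R} (fps R) (@fps_of_poly R) (@fps_of_poly_is_monoid_morphism R).

Lemma fps_of_poly_eq0 (R : nzRingType) (p : {poly R}) :
  (fps_of_poly p == 0) = (p == 0).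
Proof. by rewrite -(inj_eq (@fps_of_poly_inj R)) rmorph0. Qed.

Notation "x %:F" := (FracField.tofrac x) : ring_scope.

Lemma fraction_numden (R : idomainType) (r : {fraction R}) :
  r = (\n_(repr r))%:F / (\d_(repr r))%:F.
Proof.
have d0 : (\d_(repr r))%:F != 0 :> {fraction R} by rewrite tofrac_eq0 denom_ratioP.
apply: (mulIf d0); rewrite divfK // -{1}[r]reprK.
unlock FracField.tofrac; rewrite -[LHS]FracField.pi_mul; apply/eqmodP.
rewrite /= FracField.equivfE /FracField.mulf.
by rewrite !numden_Ratio ?mulf_neq0 ?oner_eq0 ?denom_ratioP // !mulr1 mulrC.
Qed.

Section RatToLaurent.
Variable F : fieldType.
Implicit Types r : {fraction {poly F}}.

Definition laurent_of_rat r : {fraction fps F} :=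
  (fps_of_poly \n_(repr r))%:F / (fps_of_poly \d_(repr r))%:F.

Lemma laurent_of_ratE (p q : {poly F}) : q != 0 ->
  laurent_of_rat (p%:F / q%:F) = (fps_of_poly p)%:F / (fps_of_poly q)%:F.
Proof.
move=> q0; rewrite /laurent_of_rat; set r := p%:F / q%:F.
have := fraction_numden r; set n := \n__; set d := \d__ => rE.
have d0 : d != 0 by apply: denom_ratioP.
have /eqP : r = n%:F / d%:F by [].
rewrite /r eqr_div ?tofrac_eq0 // -!tofracM tofrac_eq => /eqP pd.
by apply/eqP; rewrite eqr_div ?tofrac_eq0 ?fps_of_poly_eq0 // -!tofracM -!rmorphM /= pd.
Qed.

Lemma laurent_of_rat_poly (p : {poly F}) :
  laurent_of_rat p%:F = (fps_of_poly p)%:F.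
Proof.
by rewrite -[p%:F]divr1 -tofrac1 laurent_of_ratE ?oner_eq0 // rmorph1 tofrac1 divr1.
Qed.

Fact laurent_of_rat_is_zmod_morphism : zmod_morphism laurent_of_rat.
Proof.
move=> r t; rewrite [r in LHS]fraction_numden [t in LHS]fraction_numden.
rewrite {2 3}/laurent_of_rat.
move: \n_(repr r) \d_(repr r) (denom_ratioP (repr r)) => a b b0.
move: \n_(repr t) \d_(repr t) (denom_ratioP (repr t)) => c d d0.
have subf_div (K : fieldType) (x y z w : K) : y != 0 -> w != 0 ->
  x / y - z / w = (x * w - z * y) / (y * w).
  by move=> y0 w0; rewrite -mulNr addf_div // mulNr.
rewrite (subf_div {fraction {poly F}}) ?tofrac_eq0 // -!tofracM -tofracB.
rewrite laurent_of_ratE ?mulf_neq0 //.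
rewrite (subf_div {fraction fps F}) ?tofrac_eq0 ?fps_of_poly_eq0 //.
by rewrite -!tofracM -tofracB rmorphB !rmorphM.
Qed.

Fact laurent_of_rat_is_monoid_morphism : monoid_morphism laurent_of_rat.
Proof.
split=> [|r t]; first by rewrite -[1]tofrac1 laurent_of_rat_poly rmorph1 tofrac1.
rewrite [r in LHS]fraction_numden [t in LHS]fraction_numden.
rewrite {2 3}/laurent_of_rat.
move: \n_(repr r) \d_(repr r) (denom_ratioP (repr r)) => a b b0.
move: \n_(repr t) \d_(repr t) (denom_ratioP (repr t)) => c d d0.
by rewrite !mulf_div -!tofracM laurent_of_ratE ?mulf_neq0 // !rmorphM.
Qed.

HB.instance Definition _ := GRing.isZmodMorphism.Build
  {fraction {poly F}} {fraction fps F} laurent_of_rat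
  laurent_of_rat_is_zmod_morphism.
HB.instance Definition _ := GRing.isMonoidMorphism.Build
  {fraction {poly F}} {fraction fps F} laurent_of_rat
  laurent_of_rat_is_monoid_morphism.

End RatToLaurent.

(** The identification of M_s(F)[[z]] with M_s(F[[z]]). *)
Definition fps_mx (F : Type) (s : nat) (g : fps 'M[F]_s) : 'M[fps F]_s :=
  \matrix_(i, j) Fps (fun n => fps_coef g n i j).

Definition is_walk (l : nat) (a : l.+1.-tuple int) : Prop :=
  forall i, (i < l)%N -> a`_i.+1 - a`_i \in [:: -1; 0; 1].

Definition walk_standard (l : nat) (a : l.+1.-tuple int) : Prop :=
  forall i, (i <= l)%N -> a`_l <= a`_i.

Definition standard_walks (l : nat) (x y : int) : set (l.+1.-tuple int) :=
  [set a | [/\ is_walk a, a`_0 = x, a`_l = y & walk_standard a]]%classic.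

Lemma finite_standard_walks l x y : finite_set (@standard_walks l x y).
Proof.
pose f (u : {ffun 'I_l -> 'I_3}) : l.+1.-tuple int :=
  [tuple of mkseq (fun k => x + \sum_(i < l | (i < k)%N) ((u i)%:Z - 1)) l.+1].
apply: (@sub_finite_set _ _ (f @` setT)%classic); last first.
  exact/finite_image/finite_finset.
move=> a [wa ax _ _].
have stepP (i : 'I_l) : exists j : 'I_3, (j%:Z - 1 == a`_i.+1 - a`_i).
  have := wa i (ltn_ord i); rewrite !inE => /or3P[] /eqP ->.
  - by exists 0.
  - by exists 1.
  - by exists 2%:R.
exists [ffun i => xchoose (stepP i)] => //.
apply: eq_from_tnth => k; rewrite !(tnth_nth 0) nth_mkseq //.
elim: (k : nat) (leq_ord k) => [|n IHn] nl; first by rewrite big_pred0 ?addr0.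
rewrite (bigD1 (Ordinal nl)) //= ffunE (eqP (xchooseP (stepP _))) /=.
rewrite (eq_bigl (fun i : 'I_l => (i < n)%N)); last first.
  move=> i; rewrite ltnS -val_eqE /= andbC.
  by rewrite [RHS]ltn_neqAle.
by rewrite addrCA IHn ?subrK // ltnW.
Qed.

Section WalkWeight.
Variables (R : pzRingType) (A B C : R).

(* On walks d is -1, 0 or 1; the last branch is then d = 1. *)
Definition step_weight (d : int) : R :=
  if d == -1 then A else if d == 0 then B else C.

Definition walk_weight (l : nat) (a : l.+1.-tuple int) : R :=
  \prod_(i < l) step_weight (a`_i.+1 - a`_i).

(* The index set is finite ([finite_standard_walks]), so this [\sum_(_ \in _)]
   is the actual sum and not the default value of [fsbigop]. *)
Definition Gw : fps R :=
  Fps (fun l => \sum_(a \in @standard_walks l 0 0) walk_weight a).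

End WalkWeight.

(* Main.v *)
Require Import Defs.
From HB Require Import structures.
From mathcomp Require Import all_boot all_order all_algebra all_field.
From mathcomp Require Import boolp classical_sets functions cardinality fsbigop.
From mathcomp Require Import ring.

(** Decomposing walks gives G = 1 + z B G + z^2 C G A G.  Put U = z G A; then
    G^-1 = 1 - z B - z C U, and the matrix polynomial
    L(t) = t - z (A + B t + C t^2) over F(z) factors as
    L(t) = (G^-1 - z C t) (t - U).  Hence char_poly U divides det L(t), so its
    coefficients are algebraic over F(z).  The two factors have coprime
    determinants: modulo z, U vanishes and the left factor is 1.  This coprimality
    determines U from L and char_poly U as the unique solution of a linear system
    with algebraic coefficients.  So U is algebraic, and G = (1 - z B - z C U)^-1. *)

Set Implicit Arguments.
Unset Strict Implicit.
Unset Printing Implicit Defensive.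

Import Order.TTheory GRing.Theory Num.Theory.
Local Open Scope ring_scope.

(** * Algebraic elements of a field extension *)

Lemma irreducible_factor (E : fieldType) (p : {poly E}) :
  (1 < size p)%N -> exists2 q, irreducible_poly q & q %| p.
Proof.
have [n le_pn] := ubnP (size p); elim: n => // n IHn in p le_pn *.
move=> p_gt1; have p0 : p != 0 by rewrite -size_poly_gt0 ltnW.
have [[q [sq qp nqp]]|irr_p] :=
  pselect (exists q : {poly E}, [/\ size q != 1, q %| p & ~~ (q %= p)]); last first.
  exists p => //; split=> // q sq qp; apply: contrapT => /negP nqp.
  by apply: irr_p; exists q.
have q0 : q != 0 by apply: contraTneq qp => ->; rewrite dvd0p.
have ltqp : (size q < size p)%N.
  by rewrite ltn_neqAle dvdp_leq // andbT dvdp_size_eqp.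
have [||r irr_r rq] := IHn q; first exact: leq_trans ltqp _.
  by rewrite ltn_neqAle eq_sym size_poly_gt0 q0 andbT.
by exists r; rewrite ?(dvdp_trans rq).
Qed.

(** Adjoining one root at a time replaces a splitting field in [monic_factor_algebraic] and
    [coprimep_char_poly]. *)
Lemma root_in_extension (E : fieldType) (p : {poly E}) : (1 < size p)%N ->
  exists (L : fieldType) (g : {rmorphism E -> L}) (x : L), root (map_poly g p) x.
Proof.
move=> /irreducible_factor[q irr_q qp].
have [L _ [x qx _]] := irredp_FAdjoin irr_q.
exists L, (in_alg L), x; by apply: root_dvdp qx; rewrite dvdp_map.
Qed.

(** Every root of [q] is a root of [P], hence algebraic, and the coefficients of [q] are polynomials
    in its roots. The induction splits off one linear factor at a time; since each root lives in a
    larger field, [E] and [f] vary. *)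
Lemma monic_factor_algebraic (k E : fieldType) (f : {rmorphism k -> E})
    (P : {poly k}) (q : {poly E}) :
  P != 0 -> q \is monic -> q %| map_poly f P ->
  forall i, algebraicOver f q`_i.
Proof.
move=> P0; have [n le_qn] := ubnP (size q).
elim: n => // n IHn in E f q le_qn *; move=> mq qP i.
have [q_le1|q_gt1] := leqP (size q) 1.
  move: mq; rewrite (size1_polyC q_le1) monicE lead_coefC => /eqP ->.
  by rewrite coefC; case: ifP => _; [apply: algebraic1 | apply: algebraic0].
have [L [g [x qx]]] := root_in_extension q_gt1.
pose h : {rmorphism k -> L} := g \o f.
have gqP : map_poly g q %| map_poly h P.
  by rewrite [map_poly h P]map_poly_comp dvdp_map.
have algx : algebraicOver h x by exists P => //; apply: root_dvdp qx.
have [r rE] := factor_theorem _ _ qx.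
have mr : r \is monic by rewrite -(monicMr r (monicXsubC x)) -?rE ?map_monic.
have r0 := monic_neq0 mr.
have rP : r %| map_poly h P by apply: dvdp_trans gqP; rewrite rE dvdp_mulr.
have szr : (size r < n)%N.
  move: le_qn; rewrite -(size_map_poly g q) rE size_Mmonic ?monicXsubC //.
  by rewrite size_XsubC addn2.
have algr := IHn _ h r szr mr rP.
(* As [g] is injective, a polynomial over [k] that kills the image of the coefficient in [L] already
   kills it in [E]. *)
suff [p p0] : algebraicOver h (map_poly g q)`_i.
  by rewrite coef_map map_poly_comp fmorph_root; exists p.
rewrite rE mulrBr coefB coefMX coefMC.
apply: algebraic_sub; last exact: algebraic_mul.
by case: ifP => _ //; apply: algebraic0.
Qed.

Section AlgebraicSubfield.
Variables (k E : fieldType) (f : {rmorphism k -> E}).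

Definition algebraic_pred : {pred E} := [pred x | `[<algebraicOver f x>]].

Lemma algebraic_divring_closed : divring_closed algebraic_pred.
Proof.
split=> [|x y /asboolP ax /asboolP ay|x y /asboolP ax /asboolP ay]; apply/asboolP.
- exact: algebraic1.
- exact: algebraic_sub.
- exact: algebraic_div.
Qed.

HB.instance Definition _ :=
  GRing.isDivringClosed.Build E algebraic_pred algebraic_divring_closed.

Definition algebraic_elt := {x : E | x \in algebraic_pred}.

HB.instance Definition _ := SubType.on algebraic_elt.
HB.instance Definition _ := Choice.on algebraic_elt.
HB.instance Definition _ := [SubChoice_isSubIntegralDomain of algebraic_elt by <:].
HB.instance Definition _ := [SubIntegralDomain_isSubField of algebraic_elt by <:].

(** With the algebraic elements packaged as a field [K], linear algebra can be done over [K] and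
    mapped to [E]. *)
Lemma exists_algebraic_subfield :
  exists (K : fieldType) (g : {rmorphism K -> E}),
    forall x, algebraicOver f x <-> exists y, g y = x.
Proof.
exists algebraic_elt, val => x; split=> [/asboolP ax | [[y /asboolP ay] <- //]].
by exists (Sub x ax); apply: SubK.
Qed.

End AlgebraicSubfield.

(** * Right divisors ['X%:M - R] of a matrix polynomial *)

Section RemainderMatrix.
Variables (E : fieldType) (b : nat).
Implicit Types (d : {poly E}).

(** Each row lists the coefficients of the residues modulo [d] of a row of [M], so congruences
    modulo [d] become linear equations over [E]. Nothing is lost when [b] is at least [size d]. *)
Definition rem_mx m n d (M : 'M[{poly E}]_(m, n)) : 'M[E]_(m, n * b) :=
  \matrix_(i, a) mxvec (\matrix_(j < n, k < b) (M i j %% d)`_k) 0 a.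

Lemma rem_mxE m n d (M : 'M[{poly E}]_(m, n)) i j k :
  rem_mx d M i (mxvec_index j k) = (M i j %% d)`_k.
Proof. by rewrite mxE mxvecE mxE. Qed.

Lemma mul_rem_mx p m n d (v : 'M[E]_(p, m)) (M : 'M[{poly E}]_(m, n)) :
  v *m rem_mx d M = rem_mx d (map_mx polyC v *m M).
Proof.
apply/matrixP => i a; case/mxvec_indexP: a => j k.
rewrite rem_mxE !mxE (big_morph (fun p => p %% d) (modpD d) (mod0p d)) coef_sum.
apply: eq_bigr => l _; rewrite rem_mxE mxE.
by rewrite mul_polyC modpZl coefZ.
Qed.

Lemma rem_mx_eq m n d (M N : 'M[{poly E}]_(m, n)) :
  (forall i j, d %| (M - N) i j) -> rem_mx d M = rem_mx d N.
Proof.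
move=> dMN; apply/matrixP => i a; case/mxvec_indexP: a => j k.
rewrite !rem_mxE; suff -> : M i j %% d = N i j %% d by [].
apply/eqP; rewrite -subr_eq0 -modpN -modpD.
by have := dMN i j; rewrite !mxE.
Qed.

Lemma rem_mx_eq0 m n d (M : 'M[{poly E}]_(m, n)) :
  d != 0 -> (size d <= b)%N -> rem_mx d M = 0 -> forall i j, d %| M i j.
Proof.
move=> d0 db M0 i j; apply/eqP/polyP => k; rewrite coef0.
have [kd|dk] := ltnP k b.
  by have := rem_mxE d M i j (Ordinal kd); rewrite M0 mxE.
by rewrite nth_default // (leq_trans _ dk) // (leq_trans _ db) // ltnW // ltn_modp.
Qed.

End RemainderMatrix.

Lemma map_rem_mx (K E : fieldType) (g : {rmorphism K -> E}) b m n d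
    (M : 'M[{poly K}]_(m, n)) :
  map_mx g (rem_mx b d M) = rem_mx b (map_poly g d) (map_mx (map_poly g) M).
Proof.
apply/matrixP => i a; case/mxvec_indexP: a => j k.
by rewrite mxE !rem_mxE mxE -map_modp coef_map.
Qed.

Lemma scalemx_inj (R : idomainType) m n (a : R) :
  a != 0 -> injective (fun M : 'M[R]_(m, n) => a *: M).
Proof.
move=> a0 M N /matrixP aMN; apply/matrixP => i j.
by have := aMN i j; rewrite !mxE => /(mulfI a0).
Qed.

(** Multiplying a nonzero [u] by the monic ['X%:M - R] raises the degree by one, so the product is
    constant only for [u = 0]. *)
Lemma char_poly_mx_const (E : fieldType) m n (R : 'M[E]_n) (v : 'M[E]_(m, n)) u :
  map_mx polyC v = u *m char_poly_mx R -> v = 0.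
Proof.
move=> vE.
have step (k : nat) i j : (v i j *+ (k == 0)) =
    (if k is k'.+1 then (u i j)`_k' else 0) - \sum_l (u i l)`_k * R l j.
  have /(congr1 (fun M : 'M[{poly E}]_(m, n) => (M i j)`_k)) := vE.
  rewrite mulmxBr mul_mx_scalar !mxE coefB coefXM coefC coef_sum mulrb.
  by case: k => [|k] /= h; apply: (etrans h); congr (_ - _); apply: eq_bigr => l _;
    rewrite mxE coefMC.
suff u0 : forall i j k, (u i j)`_k = 0.
  apply/matrixP => i j; have := step 0%N i j; rewrite mulr1n mxE => ->.
  by rewrite big1 ?subrr // => l _; rewrite u0 mul0r.
pose N := \max_i \max_j size (u i j).
(* Descending induction on [k]: coefficients from [N] on vanish, and [step] expresses the one at [k]
   through those at [k.+1]. *)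
suff H M : forall i j k, (N <= k + M)%N -> (u i j)`_k = 0.
  by move=> i j k; apply: (H N); rewrite leq_addl.
elim: M => [|M IH] i j k.
  rewrite addn0 => Nk; rewrite nth_default //; apply: leq_trans Nk.
  by rewrite (leq_trans _ (leq_bigmax i)) // (leq_bigmax j).
rewrite addnS => Nk; have := step k.+1 i j; rewrite mulr0n big1 ?subr0 // => l _.
by rewrite IH ?mul0r.
Qed.

(** A common root [y] in an extension would be an eigenvalue of [R], and its eigenvector would be
    killed by [q] evaluated at [R]. *)
Lemma coprimep_char_poly (E : fieldType) n (R : 'M[E]_n.+1) (q : {poly E}) :
  horner_mx R q \in unitmx -> coprimep (char_poly R) q.
Proof.
move=> uq; apply: contraT; rewrite /coprimep neq_ltn ltnS leqn0 size_poly_eq0.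
rewrite gcdp_eq0 (negPf (monic_neq0 (char_poly_monic _))) /=.
move=> /root_in_extension[L [g [y yr]]].
have yR : root (map_poly g (char_poly R)) y.
  by apply: root_dvdp yr; rewrite dvdp_map dvdp_gcdl.
have yq : root (map_poly g q) y by apply: root_dvdp yr; rewrite dvdp_map dvdp_gcdr.
move: yR; rewrite map_char_poly -eigenvalue_root_char => /eigenvalueP[v vR v0].
have vp p : v *m horner_mx (map_mx g R) p = p.[y] *: v.
  elim/poly_ind: p => [|p c IH]; first by rewrite rmorph0 mulmx0 horner0 scale0r.
  rewrite rmorphD rmorphM /= horner_mx_X horner_mx_C mulmxDr mulmxA IH.
  by rewrite -scalemxAl vR mul_mx_scalar scalerA !hornerE scalerDl.
have := vp (map_poly g q); rewrite (rootP yq) scale0r -map_horner_mx => v'0.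
have ugq : map_mx g (horner_mx R q) \in unitmx by rewrite map_unitmx.
by move: v0; rewrite -(mulmxK ugq v) v'0 mul0mx eqxx.
Qed.

(* Writing [chi := char_poly R], one has [('X%:M - R) *m \adj L = chi *: \adj N],
   so [R *m \adj L] and ['X *: \adj L] agree modulo [chi]: this is a linear
   system for [R] with coefficients in [K], and it has only one solution because
   [chi] is coprime to [\det N]. *)
Lemma solvent_descent (K E : fieldType) (g : {rmorphism K -> E}) n
    (L : 'M[{poly K}]_n.+1) (R : 'M[E]_n.+1) (N : 'M[{poly E}]_n.+1) :
  map_mx (map_poly g) L = N *m char_poly_mx R ->
  coprimep (char_poly R) (\det N) ->
  (forall i, exists y, g y = (char_poly R)`_i) ->
  exists R0, map_mx g R0 = R.
Proof.
move=> LE cop /choice[c cE]; set chi := char_poly R in cop cE.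
have chi0 : chi != 0 by rewrite monic_neq0 ?char_poly_monic.
have szchi : size chi = n.+2 by rewrite size_char_poly.
pose d := \poly_(i < size chi) c i.
have dE : map_poly g d = chi.
  apply/polyP => i; rewrite coef_map coef_poly; case: ltnP => [_|le_i]; first exact: cE.
  by rewrite raddf0 nth_default.
have dN0 : \det N != 0.
  by apply: contraTneq cop => ->; rewrite coprimep0 -size_poly_eq1 szchi.
pose M := map_mx (map_poly g) (\adj L).
have ME : M = \adj (N *m char_poly_mx R) by rewrite /M map_mx_adj LE.
have detE : \det (N *m char_poly_mx R) = \det N * chi by rewrite det_mulmx.
(* After multiplication by [\det N], written as [\adj N *m N], the product
   [N *m char_poly_mx R *m M] collapses to the scalar [\det N * chi]. *)
have RM : char_poly_mx R *m M = chi *: \adj N.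
  have : \det N *: (char_poly_mx R *m M) = \det N *: (chi *: \adj N).
    rewrite -mul_scalar_mx -mul_adj_mx -!mulmxA (mulmxA N) ME mul_mx_adj detE.
    by rewrite mul_mx_scalar scalerA.
  exact: scalemx_inj.
pose D0 := rem_mx n.+2 d (\adj L).
have D0E : map_mx g D0 = rem_mx n.+2 chi M by rewrite map_rem_mx dE.
pose D1 := rem_mx n.+2 d ('X *: \adj L).
have RD : R *m map_mx g D0 = map_mx g D1.
  rewrite D0E mul_rem_mx map_rem_mx dE; apply: rem_mx_eq => i j.
  rewrite map_mxZ /= map_polyX -/M -mul_scalar_mx -mulmxBl -opprB.
  by rewrite mulNmx RM -scalerN mxE dvdp_mulr.
(* Uniqueness of the solution: a constant row [v] such that [chi] divides [v *m M] must vanish. *)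
have freeD : row_free (map_mx g D0).
  apply: inj_row_free => v; rewrite D0E mul_rem_mx => /rem_mx_eq0 vM.
  have {}vM i j : chi %| (map_mx polyC v *m M) i j by apply: vM; rewrite ?szchi.
  pose w := \matrix_(i, j) ((map_mx polyC v *m M) i j %/ chi).
  have wE : map_mx polyC v *m M = chi *: w.
    by apply/matrixP => i j; rewrite [RHS]mxE [w i j]mxE mulrC divpK.
  have NwE : \det N *: map_mx polyC v = w *m (N *m char_poly_mx R).
    have : chi *: (\det N *: map_mx polyC v) = chi *: (w *m (N *m char_poly_mx R)).
      rewrite scalemxAl -wE ME -mulmxA mul_adj_mx detE mul_mx_scalar scalerA.
      by rewrite mulrC.
    exact: scalemx_inj.
  (* Coprimality gives [chi %| a]. As [a *m char_poly_mx R] is [chi *: v], the constant [v] is then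
     a left multiple of [char_poly_mx R], hence zero. *)
  pose a := map_mx polyC v *m \adj (char_poly_mx R).
  have aN : \det N *: a = chi *: (w *m N).
    by rewrite /a scalemxAl NwE -!mulmxA mul_mx_adj mul_mx_scalar -scalemxAr.
  have chia i j : chi %| a i j.
    rewrite -(Gauss_dvdpr _ cop); move/matrixP: aN => /(_ i j).
    by rewrite mxE [RHS]mxE => ->; rewrite dvdp_mulr.
  pose u := \matrix_(i, j) (a i j %/ chi).
  apply: (@char_poly_mx_const _ _ _ R _ u).
  have : chi *: map_mx polyC v = chi *: (u *m char_poly_mx R).
    rewrite scalemxAl; have -> : chi *: u = a.
      by apply/matrixP => i j; rewrite mxE [u i j]mxE mulrC divpK.
    by rewrite -mulmxA mul_adj_mx mul_mx_scalar.
  exact: scalemx_inj.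
(* The unique solution is computed over [K], where both [D0] and [D1] live. *)
exists (D1 *m pinvmx D0).
by rewrite map_mxM map_pinvmx -RD mulmxKp.
Qed.

(** * ** Matrices with algebraic entries *)

Section AlgebraicMatrix.
Variables (k E : fieldType) (f : {rmorphism k -> E}).

Lemma algebraic_mulmx m n p (M : 'M[E]_(m, n)) (N : 'M[E]_(n, p)) :
  (forall i j, algebraicOver f (M i j)) -> (forall i j, algebraicOver f (N i j)) ->
  forall i j, algebraicOver f ((M *m N) i j).
Proof.
move=> aM aN i j; rewrite mxE; apply: big_ind => [|x y|l _].
- exact: algebraic0.
- exact: algebraic_add.
- exact: algebraic_mul.
Qed.

Lemma algebraic_mxB m n (M N : 'M[E]_(m, n)) :
  (forall i j, algebraicOver f (M i j)) -> (forall i j, algebraicOver f (N i j)) ->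
  forall i j, algebraicOver f ((M - N) i j).
Proof. by move=> aM aN i j; rewrite !mxE; apply: algebraic_sub. Qed.

Lemma algebraic_mxZ m n a (M : 'M[E]_(m, n)) :
  algebraicOver f a -> (forall i j, algebraicOver f (M i j)) ->
  forall i j, algebraicOver f ((a *: M) i j).
Proof. by move=> aa aM i j; rewrite mxE; apply: algebraic_mul. Qed.

(** The inverse can be taken over the subfield of algebraic elements, because [invmx] commutes with
    field morphisms. *)
Lemma algebraic_invmx n (M : 'M[E]_n) :
  (forall i j, algebraicOver f (M i j)) -> forall i j, algebraicOver f (invmx M i j).
Proof.
have [K [g algE]] := exists_algebraic_subfield f.
move=> aM; have /choice[h hE] (ij : 'I_n * 'I_n) : exists y, g y = M ij.1 ij.2.
  exact/algE/aM.
have -> : M = map_mx g (\matrix_(i, j) h (i, j)).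
  by apply/matrixP => i j; rewrite !mxE hE.
by move=> i j; rewrite -map_invmx mxE; apply/algE; eexists.
Qed.

Lemma solvent_algebraic n (L : 'M[{poly k}]_n.+1) (R : 'M[E]_n.+1)
    (N : 'M[{poly E}]_n.+1) :
  map_mx (map_poly f) L = N *m char_poly_mx R ->
  coprimep (char_poly R) (\det N) ->
  forall i j, algebraicOver f (R i j).
Proof.
move=> LE cop; have [K [g algE]] := exists_algebraic_subfield f.
(* [h] lifts [f] to [K]. It is merely a function here; [h 0 = 0] suffices to map polynomials
   coefficientwise. *)
have /choice[h hE] x : exists y, g y = f x by apply/algE/algebraic_id.
have h0 : h 0 = 0 by apply: (fmorph_inj g); rewrite hE !rmorph0.
have chi0 := monic_neq0 (char_poly_monic R).
have detL : map_poly f (\det L) = \det N * char_poly R.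
  by rewrite -det_map_mx LE det_mulmx.
have dN0 : \det N != 0.
  apply: contraTneq cop => ->.
  by rewrite coprimep0 -size_poly_eq1 size_char_poly.
have detL0 : \det L != 0.
  by rewrite -(map_poly_eq0 f) detL mulf_neq0.
(* The characteristic polynomial is a monic divisor of the image of [\det L], which has coefficients
   in [k]. *)
have algchi i : exists y, g y = (char_poly R)`_i.
  apply/algE/(monic_factor_algebraic detL0); first exact: char_poly_monic.
  by rewrite detL dvdp_mull.
have LhE : map_mx (map_poly g) (map_mx (map_poly h) L) = N *m char_poly_mx R.
  rewrite -LE; apply/matrixP => i j; rewrite !mxE; apply/polyP => l.
  by rewrite !coef_map_id0 ?rmorph0.
have [R0 <-] := solvent_descent LhE cop algchi.
by move=> i j; rewrite mxE; apply/algE; eexists.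
Qed.

End AlgebraicMatrix.

(** * ** The matrix polynomial L(t), with t = ['X], and its factorization *)

Definition quad_mx (R : comNzRingType) n (z : R) (A B C : 'M[R]_n) :
    'M[{poly R}]_n :=
  'X%:M - z%:P *: (map_mx polyC A + 'X *: map_mx polyC B + 'X^2 *: map_mx polyC C).

Lemma map_quad_mx (R S : comNzRingType) (f : {rmorphism R -> S}) n z (A B C : 'M[R]_n) :
  map_mx (map_poly f) (quad_mx z A B C) =
  quad_mx (f z) (map_mx f A) (map_mx f B) (map_mx f C).
Proof.
apply/matrixP => i j; rewrite !mxE !(rmorphB, rmorphD, rmorphM, rmorphMn) /=.
by rewrite !map_polyC !map_polyX.
Qed.

(** The left factor G^-1 - z C t, with G^-1 spelled out through [U] so that it makes sense over any
    commutative ring and commutes with morphisms. *)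
Definition quad_cofactor (R : comNzRingType) n (z : R) (B C U : 'M[R]_n) :
    'M[{poly R}]_n :=
  map_mx polyC (1%:M - z *: B - z *: (C *m U)) - ('X * z%:P) *: map_mx polyC C.

Lemma map_quad_cofactor (R S : comNzRingType) (f : {rmorphism R -> S}) n z
    (B C U : 'M[R]_n) :
  map_mx (map_poly f) (quad_cofactor z B C U) =
  quad_cofactor (f z) (map_mx f B) (map_mx f C) (map_mx f U).
Proof.
rewrite /quad_cofactor map_mxB map_mxZ rmorphM /= map_polyX map_polyC /=.
rewrite -!map_mxZ -map_mxM -!map_mxZ -(map_mx1 f) -!map_mxB -!map_mx_comp.
by congr (_ - _ *: _); apply: eq_map_mx => x /=; rewrite map_polyC.
Qed.

Lemma quad_cofactor0 (R : comNzRingType) n (B C U : 'M[R]_n) :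
  quad_cofactor 0 B C U = 1%:M.
Proof. by rewrite /quad_cofactor polyC0 mulr0 !scale0r !subr0 map_mx1. Qed.

(** In the expanded product, G^-1 U is z A, and the two terms in z C U t cancel. *)
Lemma quad_mx_factor (R : comNzRingType) n (z : R) (A B C G U : 'M[R]_n) :
  U = z *: (G *m A) -> (1%:M - z *: B - z *: (C *m U)) *m G = 1%:M ->
  quad_mx z A B C = quad_cofactor z B C U *m char_poly_mx U.
Proof.
move=> UE NG; rewrite /quad_cofactor.
have NU : (1%:M - z *: B - z *: (C *m U)) *m U = z *: A.
  by rewrite {2}UE -scalemxAr mulmxA NG mul1mx.
rewrite mulmxBl mulmxBr -map_mxM NU mul_mx_scalar.
rewrite mulmxBr mul_mx_scalar -!scalemxAl -map_mxM /quad_mx.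
apply/matrixP => i j; rewrite !mxE !(rmorphB, rmorphD, rmorphM, rmorphMn) /=.
rewrite polyC1; move: (\sum_l _) => t.
by case: (i == j); rewrite ?mulr1n ?mulr0n; ring.
Qed.

(** * ** Reduction modulo [z] *)

Section FpsConstantTerm.
Variable R : nzRingType.

Definition fps_ev0 (f : fps R) : R := fps_coef f 0.

Fact fps_ev0_is_zmod_morphism : zmod_morphism fps_ev0.
Proof. by []. Qed.

Fact fps_ev0_is_monoid_morphism : monoid_morphism fps_ev0.
Proof.
by split=> [|f g]; rewrite /fps_ev0 ?coef_fps1 // coef_fpsM big_ord1.
Qed.

HB.instance Definition _ := GRing.isZmodMorphism.Build
  (fps R) R fps_ev0 fps_ev0_is_zmod_morphism.
HB.instance Definition _ := GRing.isMonoidMorphism.Build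
  (fps R) R fps_ev0 fps_ev0_is_monoid_morphism.

End FpsConstantTerm.

(** * The quadratic matrix equation over F[[z]] *)

Section QuadraticSystem.
Variables (F : fieldType) (n : nat).
Local Notation z := (fps_of_poly ('X : {poly F})).
Local Notation cst M := (map_mx (fun x : F => fps_of_poly x%:P) M).

Lemma quadratic_system_algebraic (A B C : 'M[F]_n.+1) (G : 'M[fps F]_n.+1) :
  G = 1%:M + z *: (cst B *m G + cst C *m (z *: (G *m cst A *m G))) ->
  forall i j, algebraicOver (@laurent_of_rat F) ((G i j)%:F).
Proof.
move=> GE; have [U UE] : exists U, U = z *: (G *m cst A) by eexists.
set Ni := 1%:M - z *: cst B - z *: (cst C *m U).
(* By the definition of [U], the quadratic equation reads G = 1 + z B G + z C U G. *)
have NG : Ni *m G = 1%:M.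
  have GU : z *: (G *m cst A *m G) = U *m G by rewrite UE -scalemxAl.
  rewrite /Ni 2!mulmxBl mul1mx {1}GE GU -!scalemxAl -mulmxA scalerDr.
  by rewrite -[X in X = _]addrA -opprD addrK.
pose e : {rmorphism fps F -> {fraction fps F}} := @FracField.tofrac (fps F).
pose cf (M : 'M[F]_n.+1) := map_mx (fun x : F => (x%:P)%:F : {fraction {poly F}}) M.
have cfE M : map_mx (@laurent_of_rat F) (cf M) = map_mx e (cst M).
  by apply/matrixP => i j; rewrite !mxE laurent_of_rat_poly.
pose N := quad_cofactor z (cst B) (cst C) U.
have factE := quad_mx_factor UE NG.
have LE : map_mx (map_poly (@laurent_of_rat F)) (quad_mx ('X)%:F (cf A) (cf B) (cf C))
    = map_mx (map_poly e) N *m char_poly_mx (map_mx e U).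
  rewrite map_quad_mx !cfE /= laurent_of_rat_poly -(map_quad_mx e).
  by rewrite factE map_mxM map_char_poly_mx.
pose ev : {rmorphism fps F -> F} := @fps_ev0 F.
have z0 : ev z = 0 by rewrite /ev /= /fps_ev0 /= coefX.
have U0 : map_mx ev U = 0 by rewrite UE map_mxZ z0 scale0r.
have N0 : map_mx (map_poly ev) N = 1%:M.
  by rewrite /N map_quad_cofactor z0 quad_cofactor0.
have cop : coprimep (char_poly (map_mx e U)) (\det (map_mx (map_poly e) N)).
  (* Modulo [z], [N] is [1] and [U] is [0], so [\det N] evaluated at [U] is [1]. *)
  apply: coprimep_char_poly; rewrite det_map_mx -map_horner_mx unitmxE unitfE det_map_mx.
  rewrite tofrac_eq0; apply/eqP => /(congr1 ev); rewrite -det_map_mx.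
  rewrite map_horner_mx -det_map_mx N0 det1 rmorph1 det1 rmorph0.
  by apply/eqP/oner_neq0.
have algU := solvent_algebraic LE cop.
have algc (M : 'M[F]_n.+1) i j :
    algebraicOver (@laurent_of_rat F) (map_mx e (cst M) i j).
  by rewrite -cfE mxE; apply: algebraic_id.
have algz : algebraicOver (@laurent_of_rat F) (e z).
  by rewrite -[e z](laurent_of_rat_poly 'X); apply: algebraic_id.
have alg1 i j : algebraicOver (@laurent_of_rat F) ((1%:M : 'M_n.+1) i j).
  by rewrite mxE -(rmorph_nat (@laurent_of_rat F)); apply: algebraic_id.
have aCU := algebraic_mulmx (algc C) algU.
have aN := algebraic_mxB (algebraic_mxB alg1 (algebraic_mxZ algz (algc B)))
             (algebraic_mxZ algz aCU).
have NiE : map_mx e Ni =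
    1%:M - e z *: map_mx e (cst B) - e z *: (map_mx e (cst C) *m map_mx e U).
  by rewrite /Ni !map_mxB !map_mxZ map_mxM map_mx1.
move=> i j; have -> : (G i j)%:F = invmx (map_mx e Ni) i j.
  have NGe : map_mx e Ni *m map_mx e G = 1%:M by rewrite -map_mxM NG map_mx1.
  have [uN _] := mulmx1_unit NGe.
  by rewrite -[invmx _]mulmx1 -NGe mulKmx // mxE.
by apply: algebraic_invmx; rewrite NiE.
Qed.

End QuadraticSystem.

(** * Generating series of standard walks *)

Section StandardWalkSum.
Variables (R : pzRingType) (A B C : R).

(** An arbitrary starting height [x] makes the family closed under removal of the first step. *)
Definition walk_sum l (x : int) : R :=
  \sum_(a \in @standard_walks l x 0) walk_weight A B C a.

Lemma walk_sum0 x : walk_sum 0 x = (x == 0)%:R.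
Proof.
rewrite /walk_sum; have [->|x0] := eqVneq x 0.
  rewrite (_ : standard_walks 0 0 = [set [tuple 0]]%classic).
    by rewrite fsbig_set1 /walk_weight big_ord0.
  apply/seteqP; split=> [a [_ a0 _ _]|_ ->] /=.
    by case/tupleP: a a0 => y a /= ->; apply: val_inj; rewrite /= (tuple0 a).
  by split=> // -[|i].
rewrite fsbig1 // => a [_ a0 a1 _]; by move: x0; rewrite -a0 a1 eqxx.
Qed.

Lemma walk_sum_lt0 l x : x < 0 -> walk_sum l x = 0.
Proof.
move=> x0; rewrite /walk_sum fsbig1 // => a [_ a0 al /(_ 0%N isT)].
by rewrite a0 al leNgt x0.
Qed.

Definition cons_walk l (x : int) (a : l.+1.-tuple int) : l.+2.-tuple int :=
  [tuple of x :: a].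

Lemma cons_walk_inj l x : injective (@cons_walk l x).
Proof. by move=> a b /(congr1 val) [ab]; apply: val_inj. Qed.

Lemma walk_sum_cons l x d :
  \sum_(a \in (@cons_walk l x @` standard_walks (x + d) 0)%classic) walk_weight A B C a =
  step_weight A B C d * walk_sum l (x + d).
Proof.
rewrite fsbig_image; last by move=> a b _ _; apply: cons_walk_inj.
rewrite /walk_sum fsbig_distrr; last exact: finite_standard_walks.
apply: eq_fsbigr => a; rewrite inE => -[_ a0 _ _].
rewrite /walk_weight big_ord_recl /=; congr (step_weight _ _ _ _ * _).
by rewrite -[X in X - _]/(a`_0) a0 addrC addKr.
Qed.

(** Walks are sorted by their first step; prepending [x] keeps a walk ending at 0 standard because
    [0 <= x]. *)
Lemma standard_walks_cons l x : 0 <= x ->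
  @standard_walks l.+1 x 0 =
  (@cons_walk l x @` standard_walks (x + -1) 0 `|`
   (@cons_walk l x @` standard_walks (x + 0) 0 `|`
    @cons_walk l x @` standard_walks (x + 1) 0))%classic.
Proof.
move=> x0; apply/seteqP; split=> [a|].
  case/tupleP: a => y a [wa /= ya al sa].
  have st d : a`_0 - y = d ->
      (@cons_walk l x @` standard_walks (x + d) 0)%classic [tuple of y :: a].
    move=> ad; exists a; last by apply: val_inj; rewrite /= -ya.
    split=> [i il||//|i il]; first exact: (wa i.+1 il).
      by rewrite -ad -ya addrC subrK.
    exact: (sa i.+1 il).
  have := wa 0%N isT; rewrite !inE => /or3P[] /eqP /st.
  - by left.
  - by right; left.
  - by right; right.
have st d a : d \in [:: -1; 0; 1] ->
    (@cons_walk l x @` standard_walks (x + d) 0)%classic a ->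
    @standard_walks l.+1 x 0 a.
  move=> dP [b [wb b0 bl sb] <-]; split=> // -[|i] il //=.
  - by rewrite b0 addrC addKr.
  - exact: wb.
  - by rewrite bl.
  - exact: sb.
by move=> a [|[|]]; apply: st.
Qed.

Lemma walk_sumS l x : 0 <= x ->
  walk_sum l.+1 x =
  A * walk_sum l (x - 1) + B * walk_sum l x + C * walk_sum l (x + 1).
Proof.
move=> x0; rewrite {1}/walk_sum standard_walks_cons //.
have fin y d : finite_set (@cons_walk l y @` standard_walks (y + d) 0)%classic.
  exact/finite_image/finite_standard_walks.
(* The second vertex of the walk determines its first step, so the three images are disjoint. *)
have disj d1 d2 a : (@cons_walk l x @` standard_walks (x + d1) 0)%classic a ->
    (@cons_walk l x @` standard_walks (x + d2) 0)%classic a -> d1 = d2.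
  move=> [b [_ b0 _ _] <-] [c [_ c0 _ _]] /cons_walk_inj cb; apply: (addrI x).
  by rewrite -b0 -c0 cb.
rewrite fsbigU0 //; last 2 first.
- by rewrite finite_setU.
- by move=> a [a1 [a2|a2]]; have := disj _ _ _ a1 a2.
rewrite fsbigU0 //; last by move=> a [a1 a2]; have := disj _ _ _ a1 a2.
by rewrite !walk_sum_cons /= addrA !addr0 /step_weight /=.
Qed.

End StandardWalkSum.

(** * ** Matrix generating series indexed by the starting height *)

Section WalkSeries.
Variables (F : fieldType) (s : nat).
Local Notation z := (fps_of_poly ('X : {poly F})).
Local Notation cst M := (map_mx (fun x : F => fps_of_poly x%:P) M).

Definition coef_mx m n k (M : 'M[fps F]_(m, n)) : 'M[F]_(m, n) :=
  map_mx (fun f => fps_coef f k) M.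

Lemma coef_mxP m n (M N : 'M[fps F]_(m, n)) :
  (forall k, coef_mx k M = coef_mx k N) -> M = N.
Proof.
move=> MN; apply/matrixP => i j; apply: fpsP => k.
by have /matrixP/(_ i j) := MN k; rewrite !mxE.
Qed.

Lemma coef_mxD m n k (M N : 'M[fps F]_(m, n)) :
  coef_mx k (M + N) = coef_mx k M + coef_mx k N.
Proof. by apply/matrixP => i j; rewrite !mxE. Qed.

Lemma coef_mx_scalez m n k (M : 'M[fps F]_(m, n)) :
  coef_mx k (z *: M) = if k is l.+1 then coef_mx l M else 0.
Proof.
apply/matrixP => i j; case: k => [|k]; rewrite !mxE coef_fpsM big_ord_recl /= coefX mul0r.
  by rewrite big_ord0 addr0.
rewrite add0r big_ord_recl /= coefX mul1r subn1 big1 ?addr0 // => l _.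
by rewrite coefX mul0r.
Qed.

Lemma coef_mx_cstM n k (M : 'M[F]_s) (N : 'M[fps F]_(s, n)) :
  coef_mx k (cst M *m N) = M *m coef_mx k N.
Proof.
apply/matrixP => i j; rewrite !mxE.
rewrite (big_morph (fun f => fps_coef f k) (id1 := 0) (op1 := +%R)) //.
apply: eq_bigr => l _; rewrite !mxE coef_fpsM big_ord_recl /= coefC subn0.
by rewrite big1 ?addr0 // => t _; rewrite coefC mul0r.
Qed.

Lemma coef_mx_scalar k (a : bool) :
  coef_mx k (a%:R%:M : 'M[fps F]_s) = (a && (k == 0%N))%:R%:M.
Proof.
apply/matrixP => i j; rewrite !mxE.
by case: a; case: (i == j); rewrite ?mulr0n //= ?mulr1n ?coef_fps0 ?coef_fps1.
Qed.

Variables A B C : 'M[F]_s.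

(** The linear part of the first-step recursion; the 0 at height 0 reflects that no standard walk to
    0 starts at -1. *)
Definition height_step (D : nat -> 'M[fps F]_s) h : 'M[fps F]_s :=
  z *: ((if h is g.+1 then cst A *m D g else 0) + cst B *m D h + cst C *m D h.+1).

(** The factor [z] makes coefficient [k.+1] of [D] depend only on coefficient [k]. By linearity,
    this is uniqueness for the recursion. *)
Lemma height_step_fixpoint D : (forall h, D h = height_step D h) -> forall h, D h = 0.
Proof.
move=> DE h; apply: coef_mxP => k; rewrite [RHS](_ : _ = 0); last first.
  by apply/matrixP => i j; rewrite !mxE.
elim: k h => [|k IH] h; rewrite DE coef_mx_scalez // !coef_mxD !coef_mx_cstM !IH.
rewrite !mulmx0 !addr0; case: h => [|h]; last by rewrite coef_mx_cstM IH mulmx0.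
by apply/matrixP => i j; rewrite !mxE.
Qed.

Definition walk_series (h : nat) : 'M[fps F]_s :=
  fps_mx (Fps (fun l => walk_sum A B C l h%:Z)).

Lemma coef_walk_series k h : coef_mx k (walk_series h) = walk_sum A B C k h%:Z.
Proof. by apply/matrixP => i j; rewrite !mxE. Qed.

Lemma walk_series_rec h :
  walk_series h = (h == 0%N)%:R%:M + height_step walk_series h.
Proof.
apply: coef_mxP => -[|k]; rewrite coef_mxD coef_mx_scalar coef_mx_scalez.
  rewrite addr0 coef_walk_series walk_sum0 andbT eqz_nat.
  by case: (h == 0%N); rewrite ?mulr0n ?raddf0.
rewrite [_ == 0%N]/= andbF raddf0 add0r !coef_mxD !coef_mx_cstM !coef_walk_series.
rewrite walk_sumS // -(PoszD h 1) addn1.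
suff -> : coef_mx k (if h is g.+1 then cst A *m walk_series g else 0) =
    A *m walk_sum A B C k (h%:Z - 1) by [].
case: h => [|h].
  by rewrite walk_sum_lt0 // mulmx0; apply/matrixP => i j; rewrite !mxE.
by rewrite coef_mx_cstM coef_walk_series -addn1 PoszD addrK.
Qed.

(** Combinatorially, a walk from height [(k + h).+1] is cut at its first visit to height [h], which
    is reached by a down step. The proof instead checks that both sides satisfy the same recursion
    in [k]. *)
Lemma walk_series_mul k h :
  walk_series (k + h).+1 = walk_series k *m (z *: (cst A *m walk_series h)).
Proof.
set V := z *: _; have VE : V = z *: (cst A *m walk_series h) by [].
apply/eqP; rewrite -subr_eq0; apply/eqP; move: k.
apply: height_step_fixpoint => k.
rewrite [walk_series (k + h).+1]walk_series_rec [walk_series k in LHS]walk_series_rec.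
rewrite /height_step !addSn raddf0 add0r mulmxDl -scalemxAl !mulmxDl !mulmxBr -!mulmxA.
(* At [k = 0] the source term of [walk_series 0] contributes [V], which cancels the down-step term
   coming from [walk_series h]. *)
case: k => [|k] /=.
  rewrite mul1mx mul0mx !add0r {1}VE -scalerDr -scalerBr.
  by congr (_ *: _); rewrite -[X in X - _]addrA opprD addrACA subrr add0r opprD addrACA.
rewrite mul_scalar_mx scale0r add0r -scalerBr mulmxBr -!mulmxA.
by congr (_ *: _); rewrite !opprD addrACA [X in X + _ = _]addrACA.
Qed.

(** The recursion at height 0 involves only G and [walk_series 1], and cutting the latter at its
    first visit to 0 gives z G A G. *)
Lemma Gw_quadratic (G := fps_mx (Gw A B C)) :
  G = 1%:M + z *: (cst B *m G + cst C *m (z *: (G *m cst A *m G))).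
Proof.
have -> : G = walk_series 0 by [].
rewrite {1}walk_series_rec /height_step add0r (walk_series_mul 0 0).
by rewrite -scalemxAr mulmxA.
Qed.

End WalkSeries.

Theorem theorem2p9 (F : fieldType) (s : nat) (A B C : 'M[F]_s) (i j : 'I_s) :
  algebraicOver (@laurent_of_rat F) ((fps_mx (Gw A B C) i j)%:F).
Proof.
(* For [s = 0] there are no entries; the matrix lemmas above are stated for positive size. *)
case: s A B C i j => [|n] A B C i j; first by case: i.
exact/quadratic_system_algebraic/Gw_quadratic.
Qed.
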